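(* Consider the random profile matching problem RPMP-$k$ (defined in the context) with $n$ men, $n$ women, $k=k(n)$, under the Hamming distance $d_h(\mathbf{a},\mathbf{a}')=\sum_{i=1}^k\mathbf{1}(a_i\neq a_i')$. Then: (i) if $k(n)=\Omega(n^3)$, with high probability the fraction of participants with multiple stable partners tends to zero as $n\to\infty$; (ii) if $k(n)=\Omega(n^6)$, with high probability the stable matching is unique without resorting to tie-breaking (i.e., there is exactly one stable matching, and it does not depend on the tie-breaking lists); (iii) for any $\beta>1$, $$\mathbb{P}\left(X<\frac{k}{2}-\sqrt{\beta k\log n}\right)\le n^{1-\beta},$$ where $X$ is the matching distance of a randomly chosen participant.
   Context: RPMP-$k$: there is a set $\mathcal{M}$ of $n$ men and a set $\mathcal{W}$ of $n$ women. Each participant $x$ has a profile $\mathbf{a}(x)\in Q_k=\{0,1\}^k$; the profiles are independent and uniformly distributed on $Q_k$. Write $d_h(x,y)=d_h(\mathbf{a}(x),\mathbf{a}(y))$. Each participant $x$ has a tie-breaking list $T_x$, a uniformly random ordering of the opposite sex, all independent of each other and of the profiles. The strict preference list of $x$ ranks the opposite sex in increasing order of $d_h(x,\cdot)$, breaking ties by $T_x$. Stable matchings and blocking pairs are in the sense of Gale and Shapley; $y$ is a stable partner of $x$ if they are matched in some stable matching. The matching distance of a participant $x$ is $d_h(x,\mu(x))$ for a stable matching $\mu$ (this value is the same for all stable matchings). ''With high probability'' means with probability tending to $1$ as $n\to\infty$. $\log$ denotes the base-$2$ logarithm. *)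

(* Defs.v *)
From HB Require Import structures.
From mathcomp Require Import all_boot all_order all_algebra all_fingroup.
From mathcomp Require Import all_classical all_reals all_analysis.

Set Implicit Arguments.
Unset Strict Implicit.
Unset Printing Implicit Defensive.

Import Order.TTheory GRing.Theory Num.Theory.
Local Open Scope ring_scope.

Definition profile (k : nat) := {ffun 'I_k -> bool}.

Definition hamming (k : nat) (a b : profile k) : nat := #|[set i | a i != b i]|.

(* Sample space of RPMP-k: profiles of men, profiles of women, tie-breaking
   orderings of men (over women) and of women (over men).  A uniformly random
   ordering of 'I_n is a uniformly random permutation t; position of y is t y. *)
Definition outcome (n k : nat) : finType :=
  ({ffun 'I_n -> profile k} * {ffun 'I_n -> profile k}
   * {ffun 'I_n -> {perm 'I_n}} * {ffun 'I_n -> {perm 'I_n}})%type.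

Section RPMP.
Variables n k : nat.
Implicit Types (o : outcome n k) (mu : {perm 'I_n}).

Definition mprof o : {ffun 'I_n -> profile k} := o.1.1.1.
Definition wprof o : {ffun 'I_n -> profile k} := o.1.1.2.
Definition mtb o : {ffun 'I_n -> {perm 'I_n}} := o.1.2.
Definition wtb o : {ffun 'I_n -> {perm 'I_n}} := o.2.

Definition mprefers o (m w1 w2 : 'I_n) : bool :=
  let d w := hamming (mprof o m) (wprof o w) in
  (d w1 < d w2)%N || ((d w1 == d w2) && (mtb o m w1 < mtb o m w2)%N).

Definition wprefers o (w m1 m2 : 'I_n) : bool :=
  let d m := hamming (wprof o w) (mprof o m) in
  (d m1 < d m2)%N || ((d m1 == d m2) && (wtb o w m1 < wtb o w m2)%N).

(* A (perfect) matching mu : man m is matched with woman mu m. *)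
Definition blocking o mu (m w : 'I_n) : bool :=
  mprefers o m w (mu m) && wprefers o w m ((mu^-1)%g w).

Definition stable o mu : bool := [forall m, forall w, ~~ blocking o mu m w].

(* participants: inl m = man m, inr w = woman w *)
Definition participant := ('I_n + 'I_n)%type.

Definition stable_partners o (x : participant) : {set 'I_n} :=
  match x with
  | inl m => [set w | [exists mu, stable o mu && (mu m == w)]]
  | inr w => [set m | [exists mu, stable o mu && (mu m == w)]]
  end.

Definition multi_partner o (x : participant) : bool :=
  (1 < #|stable_partners o x|)%N.

Definition frac_multi (R : realType) o : R :=
  #|[set x : participant | multi_partner o x]|%:R / (2 * n)%:R.

Definition with_tb o (tm tw : {ffun 'I_n -> {perm 'I_n}}) : outcome n k :=
  (mprof o, wprof o, tm, tw).

Definition unique_without_tb o : bool :=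
  [exists mu0 : {perm 'I_n},
     [forall tm : {ffun 'I_n -> {perm 'I_n}}, forall tw : {ffun 'I_n -> {perm 'I_n}},
        forall mu : {perm 'I_n}, stable (with_tb o tm tw) mu == (mu == mu0)]].

(* A stable matching (chosen canonically; the matching distance does not
   depend on the choice). *)
Definition a_stable_matching o : {perm 'I_n} := odflt 1%g [pick mu | stable o mu].

Definition match_dist o (x : participant) : nat :=
  let mu := a_stable_matching o in
  match x with
  | inl m => hamming (mprof o m) (wprof o (mu m))
  | inr w => hamming (wprof o w) (mprof o ((mu^-1)%g w))
  end.

End RPMP.

Definition prob (R : realType) (T : finType) (A : pred T) : R :=
  #|[set x | A x]|%:R / #|T|%:R.

Definition bigOmega_pow (R : realType) (k : nat -> nat) (p : nat) : Prop :=
  exists c : R, 0 < c /\ exists N : nat, forall n : nat, (N <= n)%N ->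
    c * (n%:R ^+ p) <= (k n)%:R.

Definition log2 (R : realType) (x : R) : R := ln x / ln 2.

(* Main.v *)
Require Import Defs.
From HB Require Import structures.
From mathcomp Require Import all_boot all_order all_algebra all_fingroup.
From mathcomp Require Import all_classical all_reals all_analysis.
From mathcomp Require Import ring lra zify.
Import Order.TTheory GRing.Theory Num.Theory.
Import numFieldNormedType.Exports.

Set Implicit Arguments.
Unset Strict Implicit.
Unset Printing Implicit Defensive.

(* Distances are symmetric, so every participant has the same distance to its
   partner in all stable matchings.  Delete a woman w: the stable matchings of
   the remaining market do not depend on the profile of w, while the distance
   from a man to w hits any value independent of that profile with probability
   at most max_j C(k, j) / 2^k <= 1 / sqrt k.
   (i) If w has two stable partners, both at distance t, then her deletion
   leaves at most one more man unmatched at level t, so some man is still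
   matched at exactly his distance to w; hence w has several stable partners
   with probability at most n / sqrt k.
   (ii) If the stable matching depends on the tie-breaking lists, consider a
   relevant tie of minimal level t, between w and another woman for a man m (or
   the mirror case).  Below t nothing is tied and w is unmatched, so deleting w
   changes nothing there, and t is the first level at which m sees an available
   woman in the deleted market; hence this has probability at most
   2 n^2 / sqrt k.
   (iii) A union bound over the other side with the Chernoff bound. *)

(** * Stable matchings with distances and tie-breaking lists *)

Section GaleShapley.
Variables (n : nat) (pm pw : 'I_n -> rel 'I_n).
Hypothesis pm_trans : forall x, transitive (pm x).
Hypothesis pm_total : forall x (y z : 'I_n), y != z -> pm x y z || pm x z y.
Hypothesis pm_irr : forall x, irreflexive (pm x).
Hypothesis pw_irr : forall x, irreflexive (pw x).
Hypothesis pw_trans : forall x, transitive (pw x).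
Hypothesis pw_total : forall x (y z : 'I_n), y != z -> pw x y z || pw x z y.

Let best (R : {set 'I_n * 'I_n}) (m w : 'I_n) :=
  ((m, w) \notin R) && [forall v, ((m, v) \notin R) ==> (v == w) || pm m w v].

(* [R] is the set of rejections so far in deferred acceptance; the final state
   is obtained as a largest [R] satisfying [inv]. *)
Let inv (R : {set 'I_n * 'I_n}) :=
  [forall p in R, exists m', best R m' p.2 && pw p.2 m' p.1].

Let best_fun R m w1 w2 : best R m w1 -> best R m w2 -> w1 = w2.
Proof.
move=> /andP[r1 /forallP b1] /andP[r2 /forallP b2]; apply/eqP.
have /implyP/(_ r2)/orP[/eqP-> //|p12] := b1 w2.
have /implyP/(_ r1)/orP[/eqP-> //|p21] := b2 w1.
by have := pm_trans p12 p21; rewrite pm_irr.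
Qed.

Let best_ex (R : {set 'I_n * 'I_n}) m w0 : (m, w0) \notin R -> exists w, best R m w.
Proof.
move=> r0; have [i ri imax] := arg_maxnP (fun w => #|[set v | pm m w v]|) (r0 : (fun w => (m, w) \notin R) w0).
exists i; rewrite /best ri; apply/forallP => v; apply/implyP => rv.
have [//|nvi] := eqVneq v i; have := pm_total m nvi; case/orP => // pvi.
have: #|[set u | pm m i u]| < #|[set u | pm m v u]|.
  apply: proper_card; apply/properP; split.
    by apply/fintype.subsetP => u; rewrite !inE; apply: pm_trans.
  by exists i; rewrite inE // pm_irr.
by move/leq_trans => /(_ _ (imax v rv)); rewrite ltnn.
Qed.

(** If two men had the same best woman, the one she likes less could be added to a largest [R], so
    best women are distinct. A man rejected by every woman would leave each of them held by a
    different man, hence all men held, himself included. *)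
Lemma gale_shapley : exists mu : {perm 'I_n},
  forall m w, ~~ (pm m w (mu m) && pw w m ((mu^-1)%g w)).
Proof.
have inv0 : inv finset.set0 by apply/forall_inP => p; rewrite inE.
have [R /forall_inP invR Rmax] := arg_maxnP (fun R : {set 'I_n * 'I_n} => #|R|) inv0.
have invP m w : (m, w) \in R -> exists2 m', best R m' w & pw w m' m.
  by move=> /invR/existsP[m' /andP[]]; exists m'.
have best_inj m1 m2 w : best R m1 w -> best R m2 w -> m1 = m2.
  wlog p12 : m1 m2 / pw w m1 m2.
    move=> IH b1 b2; have [//|n12] := eqVneq m1 m2.
    by case/orP: (pw_total w n12) => p; [apply: IH|apply/esym/IH].
  move=> b1 b2; have [//|n12] := eqVneq m1 m2.
  have nR : (m2, w) \notin R by case/andP: b2.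
  suff /Rmax : inv ((m2, w) |: R) by rewrite /= cardsU1 nR ltnn.
  have keep m v : m != m2 -> best R m v -> best ((m2, w) |: R) m v.
    move=> nm /andP[r /forallP b]; rewrite /best !inE xpair_eqE (negPf nm) /= r.
    apply/forallP => u; have := b u.
    by rewrite !inE xpair_eqE (negPf nm).
  apply/forall_inP => -[m v]; rewrite !inE xpair_eqE => /orP[/andP[/eqP-> /eqP->]|].
    by apply/existsP; exists m1; rewrite keep.
  move=> /invP[m' b' p'] /=; apply/existsP.
  have [E|nm'] := eqVneq m' m2; last by exists m'; rewrite keep.
  subst m'; have E := best_fun b' b2; subst v.
  by exists m1; rewrite keep // (pw_trans p12 p').
have mbest m : exists w, best R m w.
  case: (pickP (fun w => (m, w) \notin R)) => [w0 /best_ex //|allR].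
  have wit w : exists m', best R m' w.
    by have /negbFE/invP[m' ? _] := allR w; exists m'.
  have [f fP] := fin_all_exists wit.
  have finj : injective f.
    by move=> w1 w2 E; apply: (best_fun (fP w1)); rewrite E; apply: fP.
  have [g fg gf] := injF_bij finj.
  by have := fP (g m); rewrite gf /best allR.
have [f fP] := fin_all_exists mbest.
have finj : injective f.
  by move=> m1 m2 E; apply: (best_inj _ _ (f m1)) => //; rewrite E.
exists (perm finj) => m w; apply/negP; rewrite permE => /andP[p1 p2].
have mR : (m, w) \in R.
  apply: contraLR p1 => nR; case/andP: (fP m) => _ /forallP/(_ w).
  rewrite nR => /orP[/eqP->|q]; first by rewrite pm_irr.
  by apply/negP => /(pm_trans q); rewrite pm_irr.
have [m' b' p'] := invP _ _ mR.
have E : w = f m' by apply: best_fun b' (fP m').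
have Em : ((perm finj)^-1)%g w = m' by rewrite E -(permE finj) permK.
rewrite Em in p2.
by have := pw_trans p2 p'; rewrite pw_irr.
Qed.

End GaleShapley.

(** * Distances to partners when women are deleted *)

Section DistanceMarket.
Variable n : nat.
Implicit Types (D : 'I_n -> 'I_n -> nat) (t tm tw : 'I_n -> {perm 'I_n}).
Implicit Types (mu nu : {perm 'I_n}) (B : {set 'I_n}).

Definition prefers D t x : rel 'I_n := fun y1 y2 =>
  (D x y1 < D x y2) || ((D x y1 == D x y2) && (t x y1 < t x y2)).

Definition transp D x y := D y x.

Definition stable_for D tm tw mu := [forall m, forall w,
  ~~ (prefers D tm m w (mu m) && prefers (transp D) tw w m ((mu^-1)%g w))].

Lemma prefers_irr D t x : irreflexive (prefers D t x).
Proof. by move=> y; rewrite /prefers eqxx !ltnn. Qed.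

Lemma prefers_trans D t x : transitive (prefers D t x).
Proof.
move=> y z u; rewrite /prefers => /orP[zy|/andP[/eqP-> zy]].
  by case/orP => [/(ltn_trans zy)->|/andP[/eqP<- _]] //; rewrite zy.
by case/orP => [->|/andP[/eqP-> /(ltn_trans zy)->]] //; rewrite eqxx orbT.
Qed.

Lemma prefers_total D t x y z : y != z -> prefers D t x y z || prefers D t x z y.
Proof.
rewrite -(inj_eq (@perm_inj _ (t x))) -(inj_eq val_inj) /= /prefers.
by case: ltngtP => //= _; rewrite neq_ltn.
Qed.

Lemma prefersW D t x y z : prefers D t x y z -> D x y <= D x z.
Proof. by case/orP => [/ltnW //|/andP[/eqP-> _]]. Qed.

Lemma ltn_prefers D t x y z : D x y < D x z -> prefers D t x y z.
Proof. by rewrite /prefers => ->. Qed.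

Lemma stable_for_exists D tm tw : exists mu, stable_for D tm tw mu.
Proof.
have [mu muP] := gale_shapley (@prefers_trans D tm) (@prefers_total D tm)
  (@prefers_irr D tm) (@prefers_irr (transp D) tw)
  (@prefers_trans (transp D) tw) (@prefers_total (transp D) tw).
by exists mu; apply/forallP => m; apply/forallP => w.
Qed.

Lemma stable_for_transp D tm tw mu :
  stable_for D tm tw mu -> stable_for (transp D) tw tm (mu^-1)%g.
Proof.
move=> /forallP s; apply/forallP => w; apply/forallP => m; rewrite invgK andbC.
exact: (forallP (s m)).
Qed.

Lemma stable_prefers_man D tm tw mu m w : stable_for D tm tw mu ->
  prefers (transp D) tw w m ((mu^-1)%g w) -> prefers D tm m (mu m) w.
Proof.
move=> /forallP/(_ m)/forallP/(_ w); rewrite negb_and => /orP[np|/negPf-> //] p.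
have [E|] := eqVneq (mu m) w; last by case/(prefers_total D tm m)/orP => // q; rewrite q in np.
by move: p; rewrite -E permK prefers_irr.
Qed.

Lemma stable_prefers_woman D tm tw mu m w : stable_for D tm tw mu ->
  prefers D tm m w (mu m) -> prefers (transp D) tw w ((mu^-1)%g w) m.
Proof.
move=> /stable_for_transp s p; apply: (stable_prefers_man s).
by rewrite invgK.
Qed.

Lemma stable_for_weak D tm tw mu m w : stable_for D tm tw mu ->
  (D m (mu m) <= D m w) || (D ((mu^-1)%g w) w <= D m w).
Proof.
move=> s; rewrite orbC; case: leqP => //= p.
by apply: (@prefersW D tm); apply: (stable_prefers_man s); apply: ltn_prefers.
Qed.

(* With [K] above all distances this deletes the women of [B] while keeping the
   two sides of equal size: their partners are the unmatched men. *)
Definition demote D K B m w := if w \in B then K else D m w.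

Section Comparison.
Variables (D : 'I_n -> 'I_n -> nat) (K : nat) (B : {set 'I_n}).
Variables (tm tw : 'I_n -> {perm 'I_n}) (mu nu : {perm 'I_n}).
Hypothesis ltDK : forall m w, D m w < K.
Hypothesis mu_stable : stable_for D tm tw mu.
Hypothesis nu_stable : stable_for (demote D K B) tm tw nu.

Let sigma := (nu * mu^-1)%g.
Let better m := (nu m \notin B) && prefers D tm m (nu m) (mu m).

Let prefers_demote m u w : w \notin B ->
  prefers (demote D K B) tm m u w -> (u \notin B) && prefers D tm m u w.
Proof.
rewrite /prefers /demote => /negPf->; case: ifP => [_|//].
have := ltDK m w; case: ltngtP => //.
Qed.

Let prefers_demoteT m u w : w \notin B ->
  prefers (transp D) tw w u m -> prefers (transp (demote D K B)) tw w u m.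
Proof. by rewrite /prefers /transp /demote => /negPf->. Qed.

(** [sigma m] is the man whom [mu] matches with [nu m]. Stability of [mu] makes [nu m] prefer him to
    [m]; stability of [nu] then makes him prefer his own [nu]-partner to her, so the improvement
    passes along the cycle of [sigma]. *)
Let better_step m : better m -> [/\ better (sigma m),
  D (sigma m) (nu (sigma m)) <= D (sigma m) (nu m) & D (sigma m) (nu m) <= D m (nu m)].
Proof.
case/andP => nB p; have E : (mu^-1)%g (nu m) = sigma m by rewrite permM.
have q := stable_prefers_woman mu_stable p; rewrite E in q.
have Emu : mu (sigma m) = nu m by rewrite permM permKV.
have := @stable_prefers_man _ tm tw nu (sigma m) (nu m) nu_stable.
rewrite permK => /(_ (prefers_demoteT nB q)) /(prefers_demote nB) /andP[nB' p'].
split; last exact: (prefersW q); first by rewrite /better nB' Emu p'.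
exact: prefersW p'.
Qed.

Let better_iter m i : better m ->
  better ((sigma ^+ i)%g m) /\ D ((sigma ^+ i)%g m) (nu ((sigma ^+ i)%g m)) <= D m (nu m).
Proof.
move=> bm; elim: i => [|i [IHb IHd]]; first by rewrite expg0 perm1.
rewrite expgSr permM; have [-> h1 h2] := better_step IHb; split => //.
exact: leq_trans h1 (leq_trans h2 IHd).
Qed.

(* Levels do not increase along a cycle of [sigma], hence are constant. *)
Let better_const m : better m -> D m (nu m) <= D (sigma m) (nu (sigma m)).
Proof.
move=> bm; have [bs _ _] := better_step bm.
have [_] := better_iter #[sigma]%g.-1 bs.
by rewrite -permM -expgS prednK ?order_gt0 // expg_order perm1.
Qed.

Let better_pred m : better m -> better ((sigma^-1)%g m).
Proof. by move=> bm; rewrite invg_expg; have [] := better_iter #[sigma]%g.-1 bm. Qed.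

(** Distances are constant along the cycle, so both inequalities of [better_step] at the predecessor
    of [m] are equalities: men can gain by tie-breaking only. *)
Let better_eq m : better m -> D m (mu m) = D m (nu m) /\
  D ((nu^-1)%g (mu m)) (mu m) = D m (mu m).
Proof.
move=> bm; have b0 := better_pred bm; set m0 := (sigma^-1)%g m in b0.
have Em : sigma m0 = m by rewrite permKV.
have En : nu m0 = mu m by rewrite -Em permM permKV.
have E0 : (nu^-1)%g (mu m) = m0 by rewrite -En permK.
have [_ h1 h2] := better_step b0; have h3 := better_const b0.
rewrite E0 -En; rewrite Em in h1 h2 h3.
by split; apply/eqP; rewrite eqn_leq ?h1 ?h2 ?(leq_trans h2 h3) ?(leq_trans h3 h1).
Qed.

Lemma demote_men_worse m : D m (mu m) <= demote D K B m (nu m).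
Proof.
rewrite leqNgt; apply/negP; rewrite /demote; case: ifPn => [_|nB lt].
  by rewrite ltnNge ltnW.
have /better_eq[E _] : better m by rewrite /better nB ltn_prefers.
by rewrite E ltnn in lt.
Qed.

(** If [w] ended up farther away, stability of [nu] would make her [mu]-partner [better], and
    [better_eq] would leave her distance unchanged. *)
Lemma demote_women_better w : w \notin B ->
  D ((nu^-1)%g w) w <= D ((mu^-1)%g w) w.
Proof.
move=> nB; rewrite leqNgt; apply/negP => lt; set m := (mu^-1)%g w in lt.
have Ew : mu m = w by rewrite permKV.
have p := @stable_prefers_man _ tm tw nu m w nu_stable.
have /p/(prefers_demote nB) q : prefers (transp (demote D K B)) tw w m ((nu^-1)%g w).
  by apply: (prefers_demoteT nB); apply: ltn_prefers.
have /better_eq[_] : better m by rewrite /better Ew.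
by rewrite Ew => E; rewrite E ltnn in lt.
Qed.

End Comparison.

Lemma demote0 D K tm tw mu :
  stable_for (demote D K finset.set0) tm tw mu = stable_for D tm tw mu.
Proof.
by apply: eq_forallb => m; apply: eq_forallb => w;
  rewrite /prefers /transp /demote !inE.
Qed.

Lemma stable_same_dist D K tm tw mu nu m : (forall m w, D m w < K) ->
  stable_for D tm tw mu -> stable_for D tm tw nu -> D m (mu m) = D m (nu m).
Proof.
move=> ltDK smu snu; apply/eqP; rewrite eqn_leq.
have := @demote_men_worse D K finset.set0 tm tw mu nu ltDK smu; rewrite demote0 => /(_ snu m).
have := @demote_men_worse D K finset.set0 tm tw nu mu ltDK snu; rewrite demote0 => /(_ smu m).
by rewrite /demote !inE => -> ->.
Qed.

Lemma two_stable_partners_tie D K tm tw mu1 mu2 nu w : (forall m w, D m w < K) ->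
  stable_for D tm tw mu1 -> stable_for D tm tw mu2 ->
  (mu1^-1)%g w != (mu2^-1)%g w -> stable_for (demote D K [set w]) tm tw nu ->
  exists m, D m w == demote D K [set w] m (nu m).
Proof.
move=> ltDK s1 s2 n12 snu.
set m1 := (mu1^-1)%g w in n12 *; set m2 := (mu2^-1)%g w in n12 *.
have E1 : mu1 m1 = w by rewrite permKV.
have E2 : mu2 m2 = w by rewrite permKV.
have ltDKT u v : transp D u v < K by apply: ltDK.
have D12 : D m2 w = D m1 w.
  have := stable_same_dist w ltDKT (stable_for_transp s2) (stable_for_transp s1).
  by [].
set t := D m1 w in D12.
set S := [set m | D m (mu1 m) <= t].
set S' := [set m | demote D K [set w] m (nu m) <= t].
have S1 : m1 \in S by rewrite inE E1.
have S2 : m2 \in S by rewrite inE (stable_same_dist m2 ltDK s1 s2) E2 D12.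
have subS : S' \subset S.
  by apply/fintype.subsetP => m; rewrite !inE; apply: leq_trans (demote_men_worse ltDK s1 snu m).
(* Each man of [S] but [m1] has a [mu1]-partner other than [w]; she does not move farther away, so
   her [nu]-partner lies in [S']. *)
have cardS : #|S| <= #|S'|.+1.
  rewrite (cardsD1 m1) S1 add1n ltnS.
  rewrite -(card_imset (S :\ m1) (@perm_inj _ (mu1 * nu^-1)%g)); apply/subset_leq_card/fintype.subsetP.
  move=> u /imsetP[m /finset.setD1P[nm]]; rewrite inE => mS ->; rewrite inE permM permKV.
  have nw : mu1 m \notin [set w] by rewrite inE -E1 (inj_eq perm_inj).
  rewrite /demote (negPf nw).
  by rewrite (leq_trans (demote_women_better ltDK s1 snu nw)) // permK.
(* A stable partner of [w] in [S'] has distance exactly [t] after the deletion, since no man gets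
   closer. *)
have tie m mu : stable_for D tm tw mu -> mu m = w -> D m w = t -> m \in S' ->
    exists m, D m w == demote D K [set w] m (nu m).
  move=> smu Em Dm; rewrite inE => le; exists m; rewrite eqn_leq Dm le andbT.
  by have := demote_men_worse ltDK smu snu m; rewrite Em Dm.
have [|nS1] := boolP (m1 \in S'); first exact: (tie _ mu1).
have [|nS2] := boolP (m2 \in S'); first exact: (tie _ mu2).
(* Otherwise [S'] misses two men of [S], against [cardS]. *)
have : S' \subset (S :\ m1) :\ m2.
  apply/fintype.subsetP => m mS; rewrite !inE.
  apply/and3P; split; last by have := fintype.subsetP subS m mS; rewrite inE.
    by apply: contraNneq nS2 => <-.
  by apply: contraNneq nS1 => <-.
move=> /subset_leq_card; rewrite leqNgt -ltnS; move/negP; case.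
move: cardS; rewrite (cardsD1 m1) S1 (cardsD1 m2 (S :\ m1)) !inE eq_sym n12.
by move: S2; rewrite inE => ->.
Qed.

End DistanceMarket.

(** * Dependence on the tie-breaking lists *)

Section TieFree.
Variable n : nat.
Implicit Types (D : 'I_n -> 'I_n -> nat) (t tm tw : 'I_n -> {perm 'I_n}).
Implicit Types (mu nu : {perm 'I_n}).

(** A pair that suitable tie-breaking lists would make blocking; [tie_free] is thus super-stability
    in the sense of preferences with ties. *)
Definition relevant D mu m w :=
  [&& w != mu m, D m w <= D m (mu m) & D m w <= D ((mu^-1)%g w) w].

Definition tie_free D mu := [forall m, forall w, ~~ relevant D mu m w].

(** A blocking pair is relevant, so [mu] is stable for any lists. Another stable matching has the
    same distances, so a pair on which it differs from [mu] would be relevant as well. *)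
Lemma tie_free_stable D K tm tw mu nu : (forall m w, D m w < K) ->
  tie_free D mu -> stable_for D tm tw nu = (nu == mu).
Proof.
move=> ltDK /forallP tf.
have smu : stable_for D tm tw mu.
  apply/forallP => m; apply/forallP => w; apply/negP => /andP[p q].
  have /forallP/(_ w) := tf m; rewrite /relevant (prefersW p) (prefersW q) !andbT negbK.
  by move=> /eqP E; rewrite E prefers_irr in p.
apply/idP/eqP => [snu|-> //]; apply/permP => m; apply/eqP.
have /forallP/(_ (nu m)) := tf m; apply: contraNT => ne.
rewrite /relevant ne (stable_same_dist m ltDK smu snu) leqnn /=.
have ltDKT u v : transp D u v < K by apply: ltDK.
have := stable_same_dist (nu m) ltDKT (stable_for_transp smu) (stable_for_transp snu).
by rewrite /transp permK => ->.
Qed.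

(* The first level at which [x] sees a partner still unmatched below it. *)
Definition first_level D nu x :=
  D x [arg min_(y < nu x | D x y <= D ((nu^-1)%g y) y) D x y].

Section Deletion.
Variables (D : 'I_n -> 'I_n -> nat) (K : nat) (tm tw : 'I_n -> {perm 'I_n}).
Variables (mu nu : {perm 'I_n}) (x y : 'I_n).
Hypothesis ltDK : forall m w, D m w < K.
Hypothesis xy_relevant : relevant D mu x y.
Hypothesis xy_min : forall m w, relevant D mu m w -> D x y <= D m w.
Hypothesis x_tie : D x (mu x) = D x y.
Hypothesis nu_stable : stable_for (demote D K [set y]) tm tw nu.

Let t := D x y.
Let D' := demote D K [set y].

Let D'E m w : w != y -> D' m w = D m w.
Proof. by rewrite /D' /demote inE => /negPf->. Qed.

Let lt_D' m w : D' m w < K -> w != y.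
Proof. by apply: contraTneq => ->; rewrite /D' /demote inE eqxx ltnn. Qed.

Let y_late a : mu a = y -> t <= D a y.
Proof. by case/and3P: xy_relevant => _ _ h /(canRL (permK mu))->. Qed.

Let below_min a b : mu a != b -> D a b < t ->
  D a (mu a) < D a b \/ D ((mu^-1)%g b) b < D a b.
Proof.
move=> ne lt; apply/orP; apply: contraLR lt; rewrite negb_or -!leqNgt => /andP[h1 h2].
by apply: xy_min; rewrite /relevant eq_sym ne h1.
Qed.

(* Up to level [t] deleting the unmatched [y] changes nothing. *)
Let agree_below a b : b != y -> D a b < t -> (nu a == b) = (mu a == b).
Proof.
elim/ltn_ind: {a b}(D a b) {-2}a {-2}b (erefl (D a b)) => s IH a b Es nby lt.
have IH' e c : c != y -> D e c < s -> (nu e == c) = (mu e == c).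
  by move=> nc ltc; apply: (IH (D e c)) => //; apply: ltn_trans ltc _; rewrite -Es.
(* If the pair is not in [mu], minimality of [t] puts [e] or [c] strictly closer in [mu]; there [nu]
   agrees by induction, so the pair is not in [nu] either. *)
have nu_mu e c : c != y -> D e c = s -> nu e = c -> mu e = c.
  move=> nc Ec nue; apply/eqP; case: (boolP (mu e == c)) => // ne.
  have ltc : D e c < t by rewrite Ec -Es.
  have [] := below_min ne ltc; rewrite Ec => h.
    have nmy : mu e != y.
      by apply: contraTneq h => E; rewrite -leqNgt E -Es ltnW // (leq_trans lt) ?y_late.
    by have := IH' _ _ nmy h; rewrite eqxx nue eq_sym (negPf ne).
  have E : (mu^-1)%g c = e.
    by apply: (@perm_inj _ nu); rewrite nue; apply/eqP; rewrite IH' ?permKV.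
  by rewrite -E permKV eqxx in ne.
have nu_mu_le e c : c != y -> D e c <= s -> nu e = c -> mu e = c.
  move=> nc; rewrite leq_eqVlt => /orP[/eqP|] h; first exact: nu_mu.
  by move=> E; apply/eqP; rewrite -IH' // E.
apply/eqP/eqP => [|mua]; first exact: nu_mu.
have ltsK : s < K by rewrite -Es.
(* By stability [nu] matches [a] or [b] within distance [s]; that pair is also in [mu], hence it is
   the pair of [a] and [b]. *)
have := stable_for_weak a b nu_stable; rewrite -/D' (D'E _ nby) Es => /orP[] h.
  have nny := lt_D' (leq_ltn_trans h ltsK).
  by rewrite (D'E _ nny) in h; rewrite -(nu_mu_le _ _ nny h).
have nny := lt_D' (leq_ltn_trans h ltsK).
rewrite (D'E _ nny) in h; have := nu_mu_le _ _ nny h (permKV _ _).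
by rewrite -mua => /perm_inj E; rewrite -{1}E permKV.
Qed.

Lemma first_level_tie : D x y = first_level D' nu x.
Proof.
rewrite /first_level; case: arg_minnP => [|b hb bmin]; first by rewrite permK.
have [yx _ _] := and3P xy_relevant.
have nzy : mu x != y by rewrite eq_sym.
apply/eqP; rewrite eqn_leq; apply/andP; split; last first.
  (* Upper bound: [mu x], tied with [y], is available to [x], for [nu] could match her below [t]
     only as [mu] does. *)
  rewrite -x_tie -(D'E _ nzy); apply: bmin; rewrite !(D'E _ nzy) leqNgt.
  apply/negP => lt; rewrite x_tie in lt.
  have := agree_below nzy lt; rewrite permKV eqxx (inj_eq perm_inj) => /esym/eqP E.
  by rewrite E x_tie ltnn in lt.
rewrite leqNgt; apply/negP => lt.
have nby := lt_D' (ltn_trans lt (ltDK x y)); rewrite !(D'E _ nby) in hb lt.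
have ne : mu x != b by apply: contraTneq lt => <-; rewrite x_tie ltnn.
have [|h] := below_min ne lt; first by rewrite x_tie ltnNge ltnW.
have E : (nu^-1)%g b = (mu^-1)%g b.
  by apply: (@perm_inj _ nu); rewrite permKV; apply/esym/eqP;
    rewrite agree_below ?permKV // (ltn_trans h).
by rewrite E leqNgt h in hb.
Qed.

End Deletion.

Definition some_stable D tm tw := odflt 1%g [pick mu | stable_for D tm tw mu].

Lemma some_stableP D tm tw : stable_for D tm tw (some_stable D tm tw).
Proof.
rewrite /some_stable; case: pickP => //= none.
by have [mu] := stable_for_exists D tm tw; rewrite none.
Qed.

Definition deleted_stable D K tm tw y := some_stable (demote D K [set y]) tm tw.

Definition deletion_tie D K tm tw x y :=
  D x y == first_level (demote D K [set y]) (deleted_stable D K tm tw y) x.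

(** At a relevant pair of least distance, stability of [mu] turns one inequality of relevance into
    an equality, the tie required by [first_level_tie]. If it is on the side of [y], the transposed
    market is used. *)
Lemma not_tie_free D K tm tw mu : (forall m w, D m w < K) ->
  stable_for D tm tw mu -> ~~ tie_free D mu ->
  [exists x, exists y, deletion_tie D K tm tw x y || deletion_tie (transp D) K tw tm x y].
Proof.
move=> ltDK smu ntf.
have {ntf} [p0 rel0] : exists p, relevant D mu p.1 p.2.
  move: ntf; rewrite negb_forall => /existsP[m]; rewrite negb_forall => /existsP[w].
  by rewrite negbK => r; exists (m, w).
have [[x y] /= rxy rmin] := @arg_minnP _ p0 (fun p => relevant D mu p.1 p.2) (fun p => D p.1 p.2) rel0.
have {}rmin m w : relevant D mu m w -> D x y <= D m w by move/(rmin (m, w)).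
have [nyx le1 le2] := and3P rxy.
have /orP[h|h] := stable_for_weak x y smu.
  apply/existsP; exists x; apply/existsP; exists y; apply/orP; left; apply/eqP.
  apply: (first_level_tie ltDK rxy rmin _ (some_stableP _ _ _)).
  by apply/eqP; rewrite eqn_leq h.
have ltDKT u v : transp D u v < K by apply: ltDK.
have relT u v : relevant (transp D) (mu^-1)%g u v = relevant D mu v u.
  rewrite /relevant /transp invgK -(inj_eq (@perm_inj _ mu)) permKV eq_sym.
  by congr (_ && _); apply: andbC.
apply/existsP; exists y; apply/existsP; exists x; apply/orP; right; apply/eqP.
apply: (@first_level_tie (transp D) K tw tm (mu^-1)%g _ y x ltDKT _ _ _ (some_stableP _ _ _)) => [|u v|].
- by rewrite relT.
- by rewrite relT => /rmin.
- by apply/eqP; rewrite eqn_leq /transp h le2.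
Qed.

End TieFree.

(** * Probability on the sample space *)

Lemma leq_bin_central m j : 'C(m.*2, j) <= 'C(m.*2, m).
Proof.
have half i : i <= m -> 'C(m.*2, m - i) <= 'C(m.*2, m).
  elim: i => [|i IH] lei; first by rewrite subn0.
  apply: leq_trans (IH (ltnW lei)).
  have E : m - i = (m - i.+1).+1 by lia.
  have := mul_bin_left m.*2 (m - i.+1); rewrite -E => h.
  rewrite -(leq_pmul2l (_ : 0 < m - i)); last by lia.
  rewrite h leq_mul2r; apply/orP; right; lia.
case: (leqP j m) => [lejm|ltmj]; first by rewrite -(subKn lejm) half ?leq_subr.
case: (leqP j m.*2) => [lej|ltj]; last by rewrite bin_small.
rewrite -bin_sub // (_ : m.*2 - j = m - (j - m)); last by lia.
by apply: half; lia.
Qed.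

(** By induction: consecutive central coefficients have ratio 2(2m+1)/(m+1), and (2m+1)(2m+3) is at
    most 4(m+1)^2. *)
Lemma bin_central_sqr m : 'C(m.*2, m) ^ 2 * m.*2.+1 <= 4 ^ m.*2.
Proof.
elim: m => [//|m IH].
have E1 : m.+1 * 'C(m.+1.*2, m.+1) = m.+1.*2 * 'C(m.*2.+1, m).
  by rewrite -mul_bin_diag.
have E2 : m.+1 * 'C(m.*2.+1, m) = m.*2.+1 * 'C(m.*2, m).
  by have := mul_bin_down m.*2.+1 m; rewrite (_ : m.*2.+1 - m = m.+1) => [<- //|]; lia.
set a := 'C(m.+1.*2, m.+1) in E1 *; set b := 'C(m.*2, m) in IH E2 *.
set c := 'C(m.*2.+1, m) in E1 E2.
have E : m.+1 * a = 2 * (m.*2.+1 * b) by rewrite E1 -E2; lia.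
rewrite -(leq_pmul2l (_ : 0 < m.+1 ^ 2)); last by rewrite expn_gt0.
have -> : m.+1 ^ 2 * (a ^ 2 * m.+1.*2.+1) = (m.+1 * a) ^ 2 * m.+1.*2.+1 by rewrite expnMn; lia.
rewrite E doubleS !expnS expn0 in IH *.
have : (m.*2.+1 * m.*2.+3 <= 4 * (m.+1 * m.+1)) by lia.
move: (4 ^ m.*2) IH => q IH; set u := m.*2.+1 in IH *; set v := u.+2.
move=> h.
have : (b * (b * 1) * u) * (u * v) <= q * (4 * (m.+1 * m.+1)) by apply: leq_mul.
nia.
Qed.

(** Integer form of the bound 1 / sqrt k on binomial point probabilities. Odd [k] reduces to the
    even case by Pascal's rule. *)
Lemma bin_sqr_le k j : 'C(k, j) ^ 2 * k <= 4 ^ k.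
Proof.
have even m i : 'C(m.*2, i) ^ 2 * m.*2.+1 <= 4 ^ m.*2.
  apply: leq_trans (bin_central_sqr m).
  by rewrite leq_mul2r leq_sqr leq_bin_central orbT.
rewrite -(odd_double_half k); case: (odd k) => /=; last first.
  by rewrite add0n (leq_trans _ (even _ j)) // leq_mul2l leqnSn orbT.
rewrite add1n; set m := k./2.
have : 'C(m.*2.+1, j) <= 2 * 'C(m.*2, m).
  case: j => [|j]; last first.
    by rewrite binS mul2n -[leqRHS]addnn leq_add ?leq_bin_central.
  by rewrite bin0 muln_gt0 bin_gt0 -addnn leq_addr.
rewrite -leq_sqr expnMn => le.
apply: leq_trans (leq_mul le (leqnn _)) _.
by rewrite -mulnA [leqRHS]expnS leq_mul // bin_central_sqr.
Qed.

(** * Uniform probability on finite types *)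

Section Prob.
Variable R : realType.
Local Open Scope ring_scope.

Lemma prob_mono (T : finType) (P Q : pred T) : (forall x, P x -> Q x) ->
  prob R P <= prob R Q.
Proof.
move=> PQ; rewrite /prob ler_wpM2r ?invr_ge0 ?ler0n // ler_nat.
by apply/subset_leq_card/fintype.subsetP => x; rewrite !inE; apply: PQ.
Qed.

Lemma prob_ge0 (T : finType) (P : pred T) : 0 <= prob R P.
Proof. by rewrite divr_ge0. Qed.

Lemma card_set_sum (T : finType) (P : pred T) : #|[set x | P x]%SET| = (\sum_x P x)%N.
Proof.
by rewrite -sum1_card big_mkcond; apply: eq_bigr => x _; rewrite inE; case: (P x).
Qed.

Lemma prob_exists (T I : finType) (P : I -> pred T) :
  prob R [pred x | [exists i, P i x]] <= \sum_i prob R (P i).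
Proof.
rewrite -mulr_suml ler_wpM2r ?invr_ge0 ?ler0n // -natr_sum ler_nat.
under [leqRHS]eq_bigr do rewrite card_set_sum.
rewrite card_set_sum exchange_big; apply: leq_sum => x _ /=.
by case: existsP => // -[i ix]; rewrite (bigD1 i) //= ix.
Qed.

Lemma prob_union_le (T I : finType) (P : I -> pred T) (c : R) :
  (forall i, prob R (P i) <= c) ->
  prob R [pred x | [exists i, P i x]] <= #|I|%:R * c.
Proof.
move=> le; apply: le_trans (prob_exists P) _.
by rewrite mulr_natl -sumr_const [leRHS](eq_bigl xpredT) // ler_sum.
Qed.

Lemma prob_predC (T : finType) (P : pred T) (x0 : T) :
  prob R P = 1 - prob R [pred x | ~~ P x].
Proof.
have T0 : #|T|%:R != 0 :> R by rewrite pnatr_eq0 -lt0n; apply/card_gt0P; exists x0.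
apply/eqP; rewrite -subr_eq opprK /prob -mulrDl -natrD.
rewrite (_ : [set x | [pred x | ~~ P x] x] = ~: [set x | P x])%SET; last by apply/setP => x; rewrite !inE.
by rewrite cardsC divff.
Qed.

Lemma prob_bij (T : finType) (P : pred T) (f : T -> T) : injective f ->
  prob R [pred x | P (f x)] = prob R P.
Proof.
move=> finj; congr (_ / _); congr (_%:R).
rewrite -(card_imset _ finj); apply: eq_card => y; rewrite !inE.
apply/imsetP/idP => [[x]|Py]; first by rewrite inE => Px ->.
by have [g fg gf] := injF_bij finj; exists (g y); rewrite ?inE /= gf.
Qed.

Lemma prob_prod (S T : finType) (P : pred (S * T)) (c : R) : 0 <= c ->
  (forall t, prob R [pred s | P (s, t)] <= c) -> prob R P <= c.
Proof.
move=> c0 le; have [T0|T0] := posnP #|{: S * T}|.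
  by rewrite /prob T0 invr0 mulr0.
rewrite /prob ler_pdivrMr ?ltr0n //.
have /andP[S_gt0 _] : (0 < #|S|)%N && (0 < #|T|)%N by rewrite -muln_gt0 -card_prod.
have -> : #|[set x | P x]%SET|%:R = \sum_t #|[set s | P (s, t)]%SET|%:R :> R.
  rewrite -natr_sum card_set_sum; congr (_%:R).
  under [RHS]eq_bigr do rewrite card_set_sum.
  by rewrite exchange_big pair_bigA /=; apply: eq_bigr => -[].
rewrite card_prod natrM mulrA mulr_natr -sumr_const [leRHS](eq_bigl xpredT) //.
apply: ler_sum => t _; rewrite -ler_pdivrMr ?ltr0n //; exact: le.
Qed.

Lemma prob_snd (S T : finType) (P : pred T) (s0 : S) :
  prob R [pred p : S * T | P p.2] = prob R P.
Proof.
rewrite /prob (_ : [set x | _]%SET = finset.setX [set: S]%SET [set x | P x]%SET).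
  rewrite cardsX cardsT card_prod !natrM -mulf_div divff ?mul1r //.
  by rewrite pnatr_eq0 -lt0n; apply/card_gt0P; exists s0.
by apply/setP => x; rewrite !inE.
Qed.

(* [(a, o) |-> (get o, set_ o a)] is an involution, so resampling one
   coordinate of [o] preserves the uniform law. *)
Lemma prob_resample (O A : finType) (get : O -> A) (set_ : O -> A -> O)
    (P : pred O) (c : R) :
  (forall o a, get (set_ o a) = a) -> (forall o a, set_ (set_ o a) (get o) = o) ->
  0 <= c -> (forall o, prob R [pred a | P (set_ o a)] <= c) -> prob R P <= c.
Proof.
move=> gs sg c0 le; have [card_O0 | O_gt0] := posnP #|{: O}|.
  by rewrite /prob card_O0 invr0 mulr0.
have /card_gt0P[x0 _] := O_gt0.
pose f (p : A * O) := (get p.2, set_ p.2 p.1).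
have fK : involutive f by move=> [a o]; rewrite /f /= gs sg.
rewrite -(prob_snd P (get x0)) -(prob_bij _ (inv_inj fK)).
exact: prob_prod.
Qed.

End Prob.

Lemma hammingC k (a b : profile k) : hamming a b = hamming b a.
Proof. by apply: eq_card => i; rewrite !inE eq_sym. Qed.

Lemma hamming_le k (a b : profile k) : hamming a b <= k.
Proof. by rewrite -[leqRHS]card_ord max_card. Qed.

Lemma card_hamming_sphere k (a : profile k) j :
  #|[set b | hamming a b == j]%SET| <= 'C(k, j).
Proof.
pose D (b : profile k) := [set i | a i != b i]%SET.
have Dinj : injective D.
  move=> b c E; apply/ffunP => i; have := congr1 (fun A : {set 'I_k} => i \in A) E.
  by rewrite !inE; case: (a i) (b i) (c i) => [] [] [].
rewrite -(card_imset _ Dinj) -[X in 'C(X, _)]card_ord -card_draws.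
apply/subset_leq_card/fintype.subsetP => A /imsetP[b]; rewrite !inE => /eqP <- ->.
by rewrite eqxx.
Qed.

Lemma card_profile k : #|{: profile k}| = 2 ^ k.
Proof. by rewrite card_ffun card_bool card_ord. Qed.

(** * Ties in a random market *)

Section Outcome.
Variables n k : nat.
Implicit Types (o : outcome n k) (mu : {perm 'I_n}) (m w : 'I_n).

Definition dist o m w := hamming (mprof o m) (wprof o w).

Lemma dist_lt o m w : dist o m w < k.+1.
Proof. by rewrite ltnS hamming_le. Qed.

Lemma stableE o mu : stable o mu = stable_for (dist o) (mtb o) (wtb o) mu.
Proof.
apply: eq_forallb => m; apply: eq_forallb => w; congr (~~ (_ && _)).
by rewrite /wprefers /prefers /transp /dist !(hammingC (wprof o w)).
Qed.

(** A measure-preserving exchange of the two sides, which carries results on women over to men. *)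
Definition swap o : outcome n k := (wprof o, mprof o, wtb o, mtb o).

Lemma swapK : involutive swap.
Proof. by move=> [[[]]]. Qed.

Lemma dist_swap o : dist (swap o) = transp (dist o).
Proof. by apply/funext => m; apply/funext => w; apply: hammingC. Qed.

Lemma stable_swap o mu : stable o mu -> stable (swap o) (mu^-1)%g.
Proof. by rewrite !stableE dist_swap => /stable_for_transp. Qed.

Definition set_wprof o w (b : profile k) : outcome n k :=
  (mprof o, [ffun v => if v == w then b else wprof o v], mtb o, wtb o).

Lemma set_wprofK o w b : set_wprof (set_wprof o w b) w (wprof o w) = o.
Proof.
case: o => [[[p q] t] u]; rewrite /set_wprof /mprof /wprof /mtb /wtb /=.
by congr (_, _, _, _); apply/ffunP => v; rewrite !ffunE; case: eqP => [->|].
Qed.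

Lemma wprof_set_wprof o w b : wprof (set_wprof o w b) w = b.
Proof. by rewrite /wprof /= ffunE eqxx. Qed.

Lemma dist_set_wprof o w b m v :
  dist (set_wprof o w b) m v = if v == w then hamming (mprof o m) b else dist o m v.
Proof. by rewrite /dist /wprof /= ffunE; case: eqP. Qed.

(** The source of independence: the market without [w] does not see her profile. *)
Lemma demote_set_wprof o w b K :
  demote (dist (set_wprof o w b)) K [set w]%SET = demote (dist o) K [set w]%SET.
Proof.
apply/funext => m; apply/funext => v.
by rewrite /demote inE dist_set_wprof; case: eqP.
Qed.

(** Distances are at most [k], so [k.+1] exceeds them all. *)
Definition deleted_dist o w := demote (dist o) k.+1 [set w]%SET.
Definition deleted_matching o w := some_stable (deleted_dist o w) (mtb o) (wtb o).

Definition tied_partner o m w :=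
  dist o m w == deleted_dist o w m (deleted_matching o w m).
Definition tied_first_level o m w :=
  dist o m w == first_level (deleted_dist o w) (deleted_matching o w) m.

Lemma multi_partner_woman o w :
  multi_partner o (inr w) -> [exists m, tied_partner o m w].
Proof.
move=> /card_gt1P[m1 [m2 []]]; rewrite !inE.
move=> /existsP[mu1 /andP[s1 /eqP E1]] /existsP[mu2 /andP[s2 /eqP E2]] ne.
rewrite !stableE in s1 s2.
apply/existsP; apply: (two_stable_partners_tie (@dist_lt o) s1 s2 _ (some_stableP _ _ _)).
by rewrite -{1}E1 -E2 !permK.
Qed.

Lemma multi_partner_man o m :
  multi_partner o (inl m) -> multi_partner (swap o) (inr m).
Proof.
move=> /card_gt1P[w1 [w2 [h1 h2 ne]]]; apply/card_gt1P; exists w1, w2; split=> //.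
- move: h1; rewrite !inE => /existsP[mu /andP[s /eqP E]]; apply/existsP; exists (mu^-1)%g.
  by rewrite stable_swap //= -E permK.
- move: h2; rewrite !inE => /existsP[mu /andP[s /eqP E]]; apply/existsP; exists (mu^-1)%g.
  by rewrite stable_swap //= -E permK.
Qed.

Lemma not_unique_tie o : ~~ unique_without_tb o ->
  [exists p : 'I_n * 'I_n, tied_first_level o p.1 p.2 ||
                           tied_first_level (swap o) p.1 p.2].
Proof.
move=> nu; have [mu smu] := stable_for_exists (dist o) (mtb o) (wtb o).
have : ~~ tie_free (dist o) mu.
  apply: contra nu => tf; apply/existsP; exists mu.
  apply/forallP => tm; apply/forallP => tw; apply/forallP => nu.
  by rewrite stableE (tie_free_stable tm tw nu (@dist_lt o) tf).
move=> /(not_tie_free (@dist_lt o) smu)/existsP[x /existsP[y h]].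
apply/existsP; exists (x, y); move: h => /=.
by rewrite /tied_first_level /deleted_matching /deleted_dist dist_swap.
Qed.

End Outcome.

(** * Probability bounds for ties *)

Section OutcomeProb.
Variables (R : realType) (n k : nat).
Implicit Types (m w : 'I_n).
Local Open Scope ring_scope.

(** Conditioning on everything but the profile of [w] fixes [S] and leaves her profile uniform. *)
Lemma prob_dist (S : outcome n k -> pred nat) m w (c : R) :
  (forall o b, S (set_wprof o w b) = S o) -> 0 <= c ->
  (forall o (a : profile k), prob R [pred b | S o (hamming a b)] <= c) ->
  prob R [pred o | S o (dist o m w)] <= c.
Proof.
move=> Sset c0 le; apply: (@prob_resample _ _ _ (fun o => wprof o w) (fun o b => set_wprof o w b)) => //.
- by move=> o a; apply: wprof_set_wprof.
- by move=> o a; apply: set_wprofK.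
move=> o; apply: le_trans (le o (mprof o m)).
by apply: prob_mono => b /=; rewrite Sset dist_set_wprof eqxx.
Qed.

Lemma prob_hamming_eq (a : profile k) j : (0 < k)%N ->
  prob R [pred b | hamming a b == j] <= (Num.sqrt k%:R)^-1.
Proof.
move=> k0; have k0R : 0 < k%:R :> R by rewrite ltr0n.
rewrite /prob card_profile.
have := card_hamming_sphere a j; set N := #|_|; move=> leN.
rewrite ler_pdivrMr ?ltr0n ?expn_gt0 // mulrC ler_pdivlMr ?sqrtr_gt0 //.
rewrite -(ler_pXn2r (_ : (0 < 2)%N)) ?nnegrE ?mulr_ge0 ?sqrtr_ge0 ?ler0n //.
have E4 : ((2 ^ k) ^ 2 = 4 ^ k)%N by rewrite -expnM mulnC expnM.
rewrite exprMn sqr_sqrtr ?ler0n // -!natrX -natrM ler_nat E4.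
by apply: leq_trans (bin_sqr_le k j); rewrite leq_mul2r leq_sqr leN orbT.
Qed.

Lemma prob_dist_eq (T : outcome n k -> nat) m w : (0 < k)%N ->
  (forall o b, T (set_wprof o w b) = T o) ->
  prob R [pred o | dist o m w == T o] <= (Num.sqrt k%:R)^-1.
Proof.
move=> k0 Tset; apply: (prob_dist (S := fun o d => d == T o)) => [x b| |x a].
- by rewrite Tset.
- by rewrite invr_ge0 sqrtr_ge0.
- exact: prob_hamming_eq.
Qed.

Lemma prob_multi_partner (x : participant n) : (0 < k)%N ->
  prob R [pred o : outcome n k | multi_partner o x] <= n%:R * (Num.sqrt k%:R)^-1.
Proof.
move=> k0.
have woman w : prob R [pred o : outcome n k | multi_partner o (inr w)]
    <= n%:R * (Num.sqrt k%:R)^-1.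
  apply: le_trans (prob_mono _ (@multi_partner_woman n k ^~ w)) _.
  rewrite -[n in leRHS]card_ord; apply: (prob_union_le (P := fun m o => tied_partner o m w)) => m.
  apply: (prob_dist_eq (T := fun o => deleted_dist o w m (deleted_matching o w m))) => // o b.
  by rewrite /deleted_matching /deleted_dist demote_set_wprof.
case: x => [m|//]; apply: le_trans (woman m).
apply: le_trans (prob_mono _ (@multi_partner_man n k ^~ m)) _.
by rewrite (prob_bij _ (fun o => multi_partner o (inr m)) (inv_inj (@swapK n k))).
Qed.

Lemma prob_not_unique : (0 < k)%N ->
  prob R [pred o : outcome n k | ~~ unique_without_tb o]
    <= (n * n)%:R * (2 * (Num.sqrt k%:R)^-1).
Proof.
move=> k0; apply: le_trans (prob_mono _ (@not_unique_tie n k)) _.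
have {1}<- : #|{: 'I_n * 'I_n}| = (n * n)%N by rewrite card_prod card_ord.
apply: (prob_union_le (P := fun p o => tied_first_level o p.1 p.2 || tied_first_level (swap o) p.1 p.2)).
move=> [m w] /=.
have one : prob R [pred o : outcome n k | tied_first_level o m w] <= (Num.sqrt k%:R)^-1.
  apply: (prob_dist_eq (T := fun o => first_level (deleted_dist o w) (deleted_matching o w) m)) => // o b.
  by rewrite /deleted_matching /deleted_dist demote_set_wprof.
apply: le_trans (prob_mono (Q := [pred o | [exists b : bool,
    tied_first_level (if b then o else swap o) m w]]) _ _) _.
  by move=> o /orP[] h; apply/existsP; [exists true|exists false].
rewrite -[2]/(2%:R) -[X in X%:R * _]card_bool.
apply: (prob_union_le (P := fun (b : bool) o => tied_first_level (if b then o else swap o) m w)) => -[//|].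
by rewrite (prob_bij _ (fun o => tied_first_level o m w) (inv_inj (@swapK n k))).
Qed.

(** Markov's inequality: the mean of [frac_multi] is the probability, over outcomes and a uniform
    participant, of having several stable partners. *)
Lemma prob_frac_multi (eps : R) : (0 < n)%N -> (0 < k)%N -> 0 < eps ->
  prob R [pred o : outcome n k | eps < frac_multi R o] <= n%:R * (Num.sqrt k%:R)^-1 / eps.
Proof.
move=> n0 k0 e0; rewrite ler_pdivlMr //.
pose P := [pred p : outcome n k * participant n | multi_partner p.1 p.2].
apply: le_trans (_ : prob R P <= _); last first.
  apply: prob_prod => [|x]; last exact: prob_multi_partner.
  by rewrite mulr_ge0 ?invr_ge0 ?sqrtr_ge0.
have cardP : #|[set p | P p]%SET|%:R = \sum_(o : outcome n k) frac_multi R o * #|{: participant n}|%:R :> R.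
  have -> : #|[set p | P p]%SET| = (\sum_(o : outcome n k) \sum_x multi_partner o x)%N.
    by rewrite card_set_sum pair_bigA.
  rewrite natr_sum.
  apply: eq_bigr => o _; rewrite -card_set_sum /frac_multi card_sum card_ord addnn -mul2n.
  by rewrite divfK // pnatr_eq0 -lt0n muln_gt0.
have parts_gt0 : #|{: participant n}|%:R != 0 :> R.
  by rewrite card_sum card_ord pnatr_eq0 -lt0n addn_gt0 n0.
rewrite /prob cardP -mulr_suml (@card_prod (outcome n k) (participant n)) natrM.
rewrite -mulf_div divff // mulr1 mulrAC.
rewrite ler_wpM2r ?invr_ge0 // card_set_sum natr_sum mulr_suml.
apply: ler_sum => o _; rewrite inE /=; case: ltP => [/ltW|_].
  by rewrite mul1r.
by rewrite mul0r divr_ge0.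
Qed.

End OutcomeProb.

(** * Lower tail of the matching distance *)

Section Tail.
Variable R : realType.
Local Open Scope ring_scope.
Implicit Types (x t : R).

(** With y = x/2, the bounds exp y <= 1/(1-y) and exp(-y) <= 1/(1+y) are squared and added, and the
    sum is compared with 2(1+x^2). *)
Lemma expR_add_expRN_le x : 0 <= x <= 1 / 2 -> expR x + expR (- x) <= 2 * expR (x ^+ 2).
Proof.
move=> /andP[x0 x1].
have p1 := expR_ge1Dx (x / 2); have q1 := expR_ge1Dx (- (x / 2)).
have pq : expR (x / 2) * expR (- (x / 2)) = 1 by rewrite expRN divff // gt_eqF // expR_gt0.
have ep : expR x = expR (x / 2) ^+ 2 by rewrite expr2 -expRD -splitr.
have eq : expR (- x) = expR (- (x / 2)) ^+ 2 by rewrite expr2 -expRD -opprD -splitr.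
have e2 := expR_ge1Dx (x ^+ 2).
apply: le_trans (_ : 2 * (1 + x ^+ 2) <= _); last by rewrite ler_pM2l.
rewrite ep eq; move: (expR (x / 2)) (expR (- (x / 2))) p1 q1 pq => p q p1 q1 pq.
set y := x / 2 in p1 q1; have -> : x = 2 * y by rewrite /y; lra.
have [y0 y1] : 0 <= y /\ y <= 1 / 4 by rewrite /y; split; lra.
have hp : p * (1 - y) <= 1 by rewrite -pq ler_pM2l //; lra.
have hq : q * (1 + y) <= 1 by rewrite -pq mulrC ler_pM2r //; lra.
have hp2 : (p * (1 - y)) ^+ 2 <= 1 by rewrite expr_le1 ?mulr_ge0 //; lra.
have hq2 : (q * (1 + y)) ^+ 2 <= 1 by rewrite expr_le1 ?mulr_ge0 //; lra.
have u0 : 0 < ((1 - y) * (1 + y)) ^+ 2 by rewrite exprn_gt0 // mulr_gt0 //; lra.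
rewrite -(ler_pM2r u0).
apply: le_trans (_ : (1 + y) ^+ 2 + (1 - y) ^+ 2 <= _).
  rewrite (_ : (p ^+ 2 + q ^+ 2) * _ =
    (p * (1 - y)) ^+ 2 * (1 + y) ^+ 2 + (q * (1 + y)) ^+ 2 * (1 - y) ^+ 2); last by ring.
  by apply: lerD; rewrite ler_piMl ?sqr_ge0.
set u := y ^+ 2; have [U0 U1] : 0 <= u /\ u <= 1 / 16 by rewrite /u; split; nra.
rewrite (_ : (1 + y) ^+ 2 + (1 - y) ^+ 2 = 2 * (1 + u)); last by rewrite /u; ring.
rewrite (_ : 2 * (1 + (2 * y) ^+ 2) * _ = 2 * ((1 + 4 * u) * (1 - u) ^+ 2)); last by rewrite /u; ring.
rewrite ler_pM2l //; nra.
Qed.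

(** The exponent is [x] times a sum of [k] independent signs, so the sum factors over
    coordinates. *)
Lemma hamming_mgf k (a : profile k) x :
  \sum_(b : profile k) expR (x * (k%:R - 2 * (hamming a b)%:R)) = (expR x + expR (- x)) ^+ k.
Proof.
pose F (i : 'I_k) (c : bool) := expR x * (if a i != c then expR (- (2 * x)) else 1).
transitivity (\prod_i \sum_c F i c).
  rewrite bigA_distr_bigA /=; apply: eq_bigr => b _.
  rewrite big_split /= prodr_const card_ord -big_mkcond /= prodr_const.
  rewrite -!expRM_natl -expRD; congr expR.
  rewrite (_ : #|_| = hamming a b); first by ring.
  by apply: eq_card => i; rewrite !inE.
rewrite (eq_bigr (fun=> expR x + expR (- x))) ?prodr_const ?card_ord // => i _.
have E : expR x * expR (- (2 * x)) = expR (- x) by rewrite -expRD; congr expR; ring.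
by rewrite big_bool /F; case: (a i); rewrite /= E mulr1 // addrC.
Qed.

Lemma hamming_tail k (a : profile k) t : (0 < k)%N -> 0 <= t ->
  prob R [pred b | (hamming a b)%:R < k%:R / 2 - t] <= expR (- (t ^+ 2 / k%:R)).
Proof.
move=> k0 t0; have k0R : 0 < k%:R :> R by rewrite ltr0n.
(* For [t] above k/2 the event is empty; otherwise the Chernoff parameter t/k is at most 1/2. *)
have [tk|kt] := lerP t (k%:R / 2); last first.
  rewrite /prob (_ : [set x | _]%SET = finset.set0).
    by rewrite cards0 mul0r expR_ge0.
  apply/setP => b; rewrite !inE; apply/negbTE; rewrite -leNgt.
  by apply: le_trans (ler0n _ _); lra.
(* This choice minimises the exponent k x^2 - 2 t x, with value -t^2/k. *)
pose x := t / k%:R.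
have xk : x * k%:R = t by rewrite /x divfK // gt_eqF.
have x0 : 0 <= x by rewrite divr_ge0.
have x1 : x <= 1 / 2 by rewrite ler_pdivrMr //; lra.
rewrite /prob card_profile ler_pdivrMr ?ltr0n ?expn_gt0 //.
rewrite (_ : t ^+ 2 / k%:R = x * t); last by rewrite /x; ring.
rewrite -(ler_pM2r (expR_gt0 (2 * t * x))).
apply: le_trans (_ : (expR x + expR (- x)) ^+ k <= _).
  rewrite -(hamming_mgf a) card_set_sum natr_sum mulr_suml; apply: ler_sum => b _ /=.
  case: ltP => [lt|_]; last by rewrite mul0r expR_ge0.
  by rewrite mul1r ler_expR; nra.
apply: le_trans (_ : (2 * expR (x ^+ 2)) ^+ k <= _).
  by rewrite lerXn2r ?nnegrE ?addr_ge0 ?mulr_ge0 ?expR_ge0 // expR_add_expRN_le // x0.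
rewrite exprMn natrX mulrAC [leRHS]mulrC ler_pM2l ?exprn_gt0 //.
by rewrite -expRM_natl -expRD ler_expR -xk; nra.
Qed.

(** The partner depends on all profiles, so the event is enlarged to some member of the opposite
    side being this close. *)
Lemma prob_match_dist n k (t : R) : (0 < k)%N -> 0 <= t ->
  prob R [pred ox : outcome n k * participant n | (match_dist ox.1 ox.2)%:R < k%:R / 2 - t]
    <= n%:R * expR (- (t ^+ 2 / k%:R)).
Proof.
move=> k0 t0; apply: prob_prod => [|x]; first by rewrite mulr_ge0 ?expR_ge0.
pose P (o : outcome n k) m w := (dist o m w)%:R < k%:R / 2 - t :> R.
have one m w : prob R [pred o | P o m w] <= expR (- (t ^+ 2 / k%:R)).
  apply: (prob_dist (S := fun _ d => d%:R < k%:R / 2 - t)) => // o a.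
  exact: hamming_tail.
case: x => [m|w].
  apply: le_trans (prob_mono (Q := [pred o | [exists w, P o m w]]) _ _) _.
    by move=> o h; apply/existsP; eexists; apply: h.
  rewrite -[n in leRHS]card_ord; by apply: (prob_union_le (P := fun w o => P o m w)) => v; apply: one.
apply: le_trans (prob_mono (Q := [pred o | [exists m, P o m w]]) _ _) _.
  by move=> o h; apply/existsP; eexists; rewrite /P /dist hammingC; apply: h.
rewrite -[n in leRHS]card_ord; by apply: (prob_union_le (P := fun m o => P o m w)) => v; apply: one.
Qed.

Lemma ln_le_log2 n : (0 < n)%N -> ln n%:R <= log2 (n%:R : R).
Proof.
move=> n0; have l0 : 0 <= ln n%:R :> R by rewrite ln_ge0 // ler1n.
have l2 : ln 2 <= 1 :> R.
  rewrite -[leRHS]expRK ler_ln ?posrE ?expR_gt0 //.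
  by have := expR_ge1Dx (1 : R); lra.
have l2' : 0 < ln 2 :> R by rewrite ln_gt0 // ltr1n.
by rewrite /log2 ler_pdivlMr // ler_piMr.
Qed.

Lemma prob_match_dist_log2 n k (beta : R) : 1 < beta -> (0 < n)%N ->
  prob R [pred ox : outcome n k * participant n | (match_dist ox.1 ox.2)%:R
       < k%:R / 2 - Num.sqrt (beta * k%:R * log2 (n%:R : R))]
    <= (n%:R : R) `^ (1 - beta).
Proof.
move=> b1 n0; have le_ln := ln_le_log2 n0.
have l0 : 0 <= ln n%:R :> R by rewrite ln_ge0 // ler1n.
(* For [k] zero the event asks for a negative distance. *)
have [->|k0] := posnP k.
  rewrite mulr0 !mul0r sqrtr0 subr0 /prob (_ : [set x | _]%SET = finset.set0).
    by rewrite cards0 mul0r powR_ge0.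
  by apply/setP => p; rewrite !inE ltNge ler0n.
apply: le_trans (prob_match_dist _ k0 (sqrtr_ge0 _)) _.
have b0 : 0 <= beta by lra.
rewrite sqr_sqrtr; last first.
  by apply: mulr_ge0 (le_trans l0 le_ln); rewrite mulr_ge0.
rewrite /powR pnatr_eq0 -[n == 0%N]negbK -lt0n n0 /=.
rewrite -{1}(lnK (_ : n%:R \is Num.pos)) ?posrE ?ltr0n // -expRD ler_expR.
rewrite (_ : _ / k%:R = beta * log2 n%:R); last by field; rewrite pnatr_eq0 -lt0n.
by nra.
Qed.
End Tail.

(** * Limits *)

Section Asymptotics.
Variable R : realType.
Local Open Scope classical_set_scope.
Local Open Scope ring_scope.

Lemma cvg0_inv_sqrt (f : nat -> R) (C : R) (N : nat) : 0 < C ->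
  (forall n, (N <= n)%N -> (0 < n)%N -> 0 <= f n <= C / Num.sqrt n%:R) -> f @ \oo --> (0 : R).
Proof.
move=> C0 le; apply/cvgrPdist_le => e e0; near=> n.
have n0 : (0 < n)%N by near: n; exact: nbhs_infty_gt.
have nN : (N <= n)%N by near: n; exact: nbhs_infty_ge.
have /andP[f0 fle] := le n nN n0.
have s0 : 0 < Num.sqrt n%:R :> R by rewrite sqrtr_gt0 ltr0n.
rewrite sub0r normrN ger0_norm // (le_trans fle) // ler_pdivrMr // mulrC -ler_pdivrMr //.
have ce0 : 0 <= C / e by rewrite divr_ge0 ?ltW.
rewrite -[leLHS]ger0_norm // -sqrtr_sqr ler_sqrt ?ler0n // ltW //.
by near: n; exact: nbhs_infty_gtr.
Unshelve. all: by end_near. Qed.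

Lemma sqrt_Omega (c : R) (n k p : nat) : 0 < c -> c * n%:R ^+ p <= k%:R ->
  Num.sqrt c * Num.sqrt n%:R ^+ p <= Num.sqrt k%:R.
Proof.
move=> c0 le; rewrite -(ler_pXn2r (_ : (0 < 2)%N)) ?nnegrE ?mulr_ge0 ?exprn_ge0 ?sqrtr_ge0 //.
by rewrite exprMn -exprM mulnC exprM !sqr_sqrtr ?ler0n // ltW.
Qed.

Lemma cvg_prob_frac_multi (k : nat -> nat) (eps : R) : bigOmega_pow R k 3 -> 0 < eps ->
  (fun n => prob R [pred o : outcome n (k n) | eps < frac_multi R o]) @ \oo --> (0 : R).
Proof.
move=> [c [c0 [N leN]]] e0; have s0 : 0 < Num.sqrt c by rewrite sqrtr_gt0.
apply: (@cvg0_inv_sqrt _ ((Num.sqrt c * eps)^-1) N); first by rewrite invr_gt0 mulr_gt0.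
move=> n /leN len n0; rewrite prob_ge0 /=.
have k0 : (0 < k n)%N.
  by rewrite -(ltr_nat R) (lt_le_trans _ len) // mulr_gt0 // exprn_gt0 // ltr0n.
apply: le_trans (prob_frac_multi n0 k0 e0) _.
(* Writing n as s^2 avoids half-integer powers: n / sqrt k is at most s^2 / (sqrt c s^3). *)
have := sqrt_Omega c0 len; set s := Num.sqrt n%:R => leS.
have S0 : 0 < s by rewrite sqrtr_gt0 ltr0n.
rewrite -[n%:R](sqr_sqrtr (ler0n _ _)) -/s.
apply: le_trans (_ : s ^+ 2 * (Num.sqrt c * s ^+ 3)^-1 / eps <= _).
  rewrite ler_pM2r ?invr_gt0 // ler_pM2l ?exprn_gt0 // lef_pV2 // posrE.
    by rewrite sqrtr_gt0 ltr0n.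
  by rewrite mulr_gt0 // exprn_gt0.
rewrite [leLHS](_ : _ = (Num.sqrt c * eps)^-1 / s) //; field; rewrite !gt_eqF //.
Qed.

Lemma cvg_prob_unique (k : nat -> nat) : bigOmega_pow R k 6 ->
  (fun n => prob R [pred o : outcome n (k n) | unique_without_tb o]) @ \oo --> (1 : R).
Proof.
move=> [c [c0 [N leN]]]; have s0 : 0 < Num.sqrt c by rewrite sqrtr_gt0.
pose f n := prob R [pred o : outcome n (k n) | ~~ unique_without_tb o].
rewrite (_ : (fun n => _) = (fun n => 1 - f n)); last first.
  apply/funext => n; apply: prob_predC.
  (* The complement rule needs a nonempty sample space; any outcome serves. *)
  pose p : {ffun 'I_n -> profile (k n)} := [ffun=> [ffun=> false]].
  pose t : {ffun 'I_n -> {perm 'I_n}} := [ffun=> 1%g].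
  exact: (p, p, t, t).
rewrite -[X in _ --> X]subr0; apply: cvgB; first exact: cvg_cst.
apply: (@cvg0_inv_sqrt _ (2 / Num.sqrt c) N); first by rewrite divr_gt0.
move=> n /leN len n0; rewrite prob_ge0 /=.
have k0 : (0 < k n)%N.
  by rewrite -(ltr_nat R) (lt_le_trans _ len) // mulr_gt0 // exprn_gt0 // ltr0n.
apply: le_trans (prob_not_unique R n k0) _.
have := sqrt_Omega c0 len; set s := Num.sqrt n%:R => leS.
(* The bound obtained is of order 1 / s^2; one factor is dropped, using s >= 1, to fit
   [cvg0_inv_sqrt]. *)
have S1 : 1 <= s by rewrite -[leLHS]sqrtr1 ler_sqrt ?ler0n // ler1n.
have S0 : 0 < s by rewrite (lt_le_trans _ S1).
rewrite natrM -[n%:R](sqr_sqrtr (ler0n _ _)) -/s.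
apply: le_trans (_ : s ^+ 2 * s ^+ 2 * (2 * (Num.sqrt c * s ^+ 6)^-1) <= _).
  rewrite ler_pM2l ?mulr_gt0 ?exprn_gt0 // ler_pM2l // lef_pV2 // posrE.
    by rewrite sqrtr_gt0 ltr0n.
  by rewrite mulr_gt0 // exprn_gt0.
rewrite [leLHS](_ : _ = 2 / Num.sqrt c / s * s^-1); last by field; rewrite !gt_eqF.
by rewrite ler_piMr ?invf_le1 // !divr_ge0 // ltW.
Qed.

End Asymptotics.

Unset Implicit Arguments.
Local Open Scope classical_set_scope.
Local Open Scope ring_scope.

Theorem theorem3p3 (R : realType) (k : nat -> nat) :
  (bigOmega_pow R k 3 ->
     forall eps : R, 0 < eps ->
       (fun n : nat => prob R [pred o : outcome n (k n) | eps < frac_multi R o])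
         @ \oo --> (0 : R))
  /\
  (bigOmega_pow R k 6 ->
     (fun n : nat => prob R [pred o : outcome n (k n) | unique_without_tb o])
       @ \oo --> (1 : R))
  /\
  (forall (beta : R) (n : nat), 1 < beta -> (0 < n)%N ->
     prob R [pred ox : (outcome n (k n) * participant n)%type |
               (match_dist ox.1 ox.2)%:R
                 < (k n)%:R / 2 - Num.sqrt (beta * (k n)%:R * log2 (n%:R : R))]
       <= (n%:R : R) `^ (1 - beta)).
Proof.
split; first by move=> Ok eps; apply: cvg_prob_frac_multi.
split; first exact: cvg_prob_unique.
by move=> beta n; apply: prob_match_dist_log2.
Qed.
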